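(* Let $\mathcal{A}_1=\mathbb{C}1\oplus\mathcal{A}_1^0$ and $\mathcal{A}_2=\mathbb{C}1\oplus\mathcal{A}_2^0$ be two augmented unital complex algebras equipped with triples of linear functionals $(\psi_i,\varphi_i,\omega_i)$ on $\mathcal{A}_i$ ($i=1,2$), where $\psi_i,\varphi_i$ are unital, $\omega_i$ is tracial and $\omega_1(1_{\mathcal{A}_1})=\omega_2(1_{\mathcal{A}_2})$. Let $(\psi,\varphi,\omega)=(\psi_1,\varphi_1,\omega_1)\circledast(\psi_2,\varphi_2,\omega_2)$ on $\mathcal{A}_1\star\mathcal{A}_2$. Assume $\psi_1=\varphi_1$ and $\psi_2=\varphi_2$. Then for any sequence $(a_1,\dots,a_n)$ of $\mathcal{A}_1\cup\mathcal{A}_2$ which is alternating and centered with respect to $\varphi$, $$\varphi(a_1\cdots a_n)=0\quad\text{and}\quad \omega(a_1\cdots a_n)=\sum_{i=1}^n\omega(a_i)\,\varphi(a_{i+1}\cdots a_n\cdot a_1\cdots a_{i-1}).$$ In particular, whenever $\varphi$ is tracial, $\mathcal{A}_1$ and $\mathcal{A}_2$ are infinitesimally free with respect to $(\varphi,\omega)$.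
   Context: Here $\mathcal{A}_i$ is the unitization of an algebra $\mathcal{A}_i^0$. $\star$ is the free product of unital algebras with identification of units. Tracial: $\omega(ab)=\omega(ba)$. A sequence $(a_1,\dots,a_n)$ with $a_j\in\mathcal{A}_{i_j}$ is alternating if $i_1\ne i_2\ne\cdots\ne i_n$; cyclically alternating if moreover $i_n\ne i_1$ (so $n\ge2$); centered w.r.t. $\psi$ if $\psi(a_j)=0$ for all $j$. $(\psi_1,\varphi_1,\omega_1)\circledast(\psi_2,\varphi_2,\omega_2)=(\psi,\varphi,\omega)$ is the unique triple of linear functionals on $\mathcal{A}_1\star\mathcal{A}_2$ extending the given ones, with $\omega$ tracial, such that: for every alternating sequence in $\mathcal{A}_1\cup\mathcal{A}_2$ centered w.r.t. $\psi$, $\psi(a_1\cdots a_n)=0$ and $\varphi(a_1\cdots a_n)=\varphi(a_1)\cdots\varphi(a_n)$; and for every cyclically alternating sequence centered w.r.t. $\psi$, $\omega(a_1\cdots a_n)=\varphi(a_1)\cdots\varphi(a_n)$. Infinitesimal freeness: for linear functionals $\varphi,\varphi'$ on a unital algebra with $\varphi$ unital (no condition on $\varphi'(1)$), unital subalgebras $\mathcal{A}_1,\mathcal{A}_2$ are infinitesimally free w.r.t. $(\varphi,\varphi')$ if for any alternating sequence in $\mathcal{A}_1\cup\mathcal{A}_2$ centered w.r.t. $\varphi$, $\varphi(a_1\cdots a_n)=0$ and $\varphi'(a_1\cdots a_n)=\sum_{i=1}^n\varphi'(a_i)\varphi(a_1\cdots a_{i-1}\cdot a_{i+1}\cdots a_n)$.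 *)

(* Defs.v *)
From mathcomp Require Import all_boot all_order all_algebra.
From mathcomp Require Import classical_sets reals complex.

Set Implicit Arguments.
Unset Strict Implicit.
Unset Printing Implicit Defensive.

Import GRing.Theory.
Local Open Scope classical_set_scope.
Local Open Scope ring_scope.

(* The ideal [A0] makes [A] its unitization: [A = C1 (+) A0]. *)
Definition augmented (R : realType) (A : algType R[i]) (A0 : set A) : Prop :=
  [/\ GRing.submod_closed (mem A0), GRing.mulr_2closed (mem A0)
    & forall a : A, exists! c : R[i], A0 (a - c%:A)].

(* [A] with [j1], [j2] is the coproduct of [A1] and [A2] among unital algebras.
   Members of [algType] are nonzero rings; omitting the zero ring as a target
   is harmless, since it always receives exactly one morphism. *)
Definition is_free_product (R : realType) (A1 A2 A : algType R[i])
    (j1 : {lrmorphism A1 -> A}) (j2 : {lrmorphism A2 -> A}) : Prop :=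
  forall (B : algType R[i])
         (f1 : {lrmorphism A1 -> B}) (f2 : {lrmorphism A2 -> B}),
  exists f : {lrmorphism A -> B},
    [/\ f \o j1 =1 f1, f \o j2 =1 f2
      & forall g : {lrmorphism A -> B},
          g \o j1 =1 f1 -> g \o j2 =1 f2 -> g =1 f].

Definition tracial (R : realType) (A : algType R[i]) (w : {scalar A}) : Prop :=
  forall x y : A, w (x * y) = w (y * x).

(* [t] records, for each entry of [s], a subset ([false] for [S1], [true] for
   [S2]) to which this entry belongs. *)
Definition labelled (R : realType) (A : algType R[i]) (S1 S2 : set A)
    (t : seq bool) (s : seq A) : Prop :=
  all2 (fun (i : bool) (x : A) => x \in if i then S2 else S1) t s.

Definition alternating (R : realType) (A : algType R[i]) (S1 S2 : set A)
    (s : seq A) : Prop :=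
  s != [::] /\
  exists2 t, labelled S1 S2 t s & sorted (fun i k : bool => i != k) t.

(* [cycle] also compares the last label with the first one, which rules out
   sequences of length 1. *)
Definition cyclically_alternating (R : realType) (A : algType R[i])
    (S1 S2 : set A) (s : seq A) : Prop :=
  s != [::] /\
  exists2 t, labelled S1 S2 t s & cycle (fun i k : bool => i != k) t.

Definition centered (R : realType) (A : algType R[i]) (psi : {scalar A})
    (s : seq A) : Prop :=
  {in s, forall x, psi x = 0}.

(* These conditions determine [psi], [phi] and [omega], since [A] is spanned by
   [1] and the products of centered alternating sequences. *)
Record is_cyclic_cfree_product (R : realType) (A1 A2 A : algType R[i])
    (j1 : {lrmorphism A1 -> A}) (j2 : {lrmorphism A2 -> A})
    (psi1 phi1 omega1 : {scalar A1}) (psi2 phi2 omega2 : {scalar A2})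
    (psi phi omega : {scalar A}) : Prop := {
  ccf_psi1 : forall a, psi (j1 a) = psi1 a;
  ccf_psi2 : forall a, psi (j2 a) = psi2 a;
  ccf_phi1 : forall a, phi (j1 a) = phi1 a;
  ccf_phi2 : forall a, phi (j2 a) = phi2 a;
  ccf_omega1 : forall a, omega (j1 a) = omega1 a;
  ccf_omega2 : forall a, omega (j2 a) = omega2 a;
  ccf_tracial : tracial omega;
  ccf_psiM : forall s, alternating (range j1) (range j2) s -> centered psi s ->
    psi (\prod_(x <- s) x) = 0;
  ccf_phiM : forall s, alternating (range j1) (range j2) s -> centered psi s ->
    phi (\prod_(x <- s) x) = \prod_(x <- s) phi x;
  ccf_omegaM : forall s, cyclically_alternating (range j1) (range j2) s ->
    centered psi s -> omega (\prod_(x <- s) x) = \prod_(x <- s) phi x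
}.

Record infinitesimally_free (R : realType) (A : algType R[i])
    (phi phi' : {scalar A}) (S1 S2 : set A) : Prop := {
  inffree_unital : phi 1 = 1;
  inffree_subalg1 : GRing.subalg_closed (mem S1);
  inffree_subalg2 : GRing.subalg_closed (mem S2);
  inffree_phi : forall s, alternating S1 S2 s -> centered phi s ->
    phi (\prod_(x <- s) x) = 0;
  inffree_phi' : forall s, alternating S1 S2 s -> centered phi s ->
    phi' (\prod_(x <- s) x) =
    \sum_(i < size s)
      phi' s`_i * phi (\prod_(x <- take i s) x * \prod_(x <- drop i.+1 s) x)
}.

(* Main.v *)
Require Import Defs.
From mathcomp Require Import all_boot all_order all_algebra.
From mathcomp Require Import classical_sets reals complex.

(** The hypothesis [psi_i = phi_i] makes [psi] and [phi] agree on the letters,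
    so a word centered for [phi] is centered for [psi], and the multiplicative
    conditions of the product collapse: [phi] vanishes on alternating centered
    words and [omega] on cyclically alternating centered ones.  The formula for
    [omega] follows from these two facts, traciality, [phi 1 = 1] and closure of
    the two sets of letters under the algebra operations
    ([cyclic_leibniz_formula]).

    If the word [a_1 ... a_n] is cyclically alternating, both sides vanish: on
    the right, deleting one letter from a cyclic word and reading on from the
    gap leaves an alternating centered word.  A word of length one is the case
    [phi 1 = 1].  Otherwise [a_1] and [a_n] lie in the same algebra and can be
    merged: with [z = a_n a_1 - phi(a_n a_1) 1], the words
    [z a_2 ... a_(n-1)] (for [omega], after rotating) and
    [a_(i+1) ... a_(n-1) z a_2 ... a_(i-1)] (for [phi]) are handled by the
    cyclically alternating case.  Hence passing from [a_1 ... a_n] to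
    [a_2 ... a_(n-1)] pulls the factor [phi(a_n a_1)] out of both sides
    ([omega_peel] and [cyclic_leibniz_peel]), and one concludes by induction on
    the length.

    When [phi] is tracial, the two factors inside [phi] can be exchanged, which
    gives infinitesimal freeness. *)

Set Implicit Arguments.
Unset Strict Implicit.
Unset Printing Implicit Defensive.

Import GRing.Theory.
Local Open Scope classical_set_scope.
Local Open Scope ring_scope.

(** * Labelled words *)

Lemma all2_drop (S T : Type) (r : S -> T -> bool) n t s :
  all2 r t s -> all2 r (drop n t) (drop n s).
Proof. by elim: n t s => [|n IHn] [|x t] [|y s] //= /andP[_ /IHn]. Qed.

Lemma all2_take (S T : Type) (r : S -> T -> bool) n t s :
  all2 r t s -> all2 r (take n t) (take n s).
Proof.
by elim: n t s => [|n IHn] [|x t] [|y s] //= /andP[-> /IHn].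
Qed.

Lemma all2_cat (S T : Type) (r : S -> T -> bool) t1 s1 t2 s2 :
  all2 r t1 s1 -> all2 r t2 s2 -> all2 r (t1 ++ t2) (s1 ++ s2).
Proof. by elim: t1 s1 => [|x t1 IHt] [|y s1] //= /andP[-> /IHt]. Qed.

Lemma all2_rcons (S T : Type) (r : S -> T -> bool) t x s y :
  all2 r (rcons t x) (rcons s y) = all2 r t s && r x y.
Proof.
elim: t s => [|x' t IHt] [|y' s] //=; rewrite ?andbT ?IHt ?andbA //.
  by case: s => [|? ?]; rewrite andbF.
by case: t {IHt} => [|? ?]; rewrite andbF.
Qed.

Lemma all2_size (S T : Type) (r : S -> T -> bool) t s :
  all2 r t s -> size t = size s.
Proof. by rewrite all2E => /andP[/eqP]. Qed.

Lemma cycle_delete_sorted (T : Type) (r : rel T) (t : seq T) i :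
  (i < size t)%N -> cycle r t -> sorted r (drop i.+1 t ++ take i t).
Proof.
case: t => // x0 t0; set t := x0 :: t0 => lt_it.
rewrite -(rot_cycle i) /rot (drop_nth x0 lt_it) /= rcons_path => /andP[+ _].
exact: path_sorted.
Qed.

(** A cyclic word can be read from any position, so the gap left by a deleted
    letter serves as its starting point, and no two equal labels meet. *)
Lemma cyclically_alternating_delete (R : realType) (A : algType R[i])
    (S1 S2 : set A) (s : seq A) i :
  cyclically_alternating S1 S2 s -> (i < size s)%N ->
  alternating S1 S2 (drop i.+1 s ++ take i s).
Proof.
move=> [_ [t lts cyc_t]] lt_is; have size_ts := all2_size lts.
split; last first.
  exists (drop i.+1 t ++ take i t).
    by apply: all2_cat; [exact: all2_drop | exact: all2_take].
  by apply: cycle_delete_sorted; rewrite // size_ts.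
(* The label of a one-letter word would have to differ from itself. *)
have lt1s : (1 < size s)%N.
  rewrite -size_ts; case: t {lts} cyc_t size_ts lt_is => [|b [|c t]] //=.
    by move=> _ <-.
  by rewrite eqxx.
rewrite -size_eq0 size_cat size_drop size_takel ?(ltnW lt_is) //.
rewrite addnC subnS -lt0n; case: i lt_is => [|i] //= _.
by rewrite add0n subn0 -subn1 subn_gt0.
Qed.

(** * The formula for the cyclic functional *)

Definition cyclic_leibniz (R : realType) (A : algType R[i])
    (phi omega : {scalar A}) (s : seq A) : R[i] :=
  \sum_(i < size s)
    omega s`_i * phi (\prod_(x <- drop i.+1 s) x * \prod_(x <- take i s) x).

Lemma phi_cyclic_delete (R : realType) (A : algType R[i])
    (S1 S2 : set A) (phi : {scalar A}) (s : seq A) :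
  (forall s', alternating S1 S2 s' -> centered phi s' ->
     phi (\prod_(x <- s') x) = 0) ->
  cyclically_alternating S1 S2 s -> centered phi s ->
  forall i, (i < size s)%N ->
    phi (\prod_(x <- drop i.+1 s) x * \prod_(x <- take i s) x) = 0.
Proof.
move=> phi_alt cyc_s cen_s i lt_is; rewrite -big_cat /=; apply: phi_alt.
  exact: cyclically_alternating_delete.
move=> x; rewrite mem_cat => /orP[/mem_drop | /mem_take]; exact: cen_s.
Qed.

(** * Merging the outer letters *)

Definition center (R : realType) (A : algType R[i]) (phi : {scalar A}) (z : A)
  : A := z - (phi z)%:A.

Lemma phi_center (R : realType) (A : algType R[i]) (phi : {scalar A}) (z : A) :
  phi 1 = 1 -> phi (center phi z) = 0.
Proof. by move=> phi1; rewrite linearB linearZ /= phi1 mulr1 subrr. Qed.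

Lemma mul_center (R : realType) (A : algType R[i]) (phi : {scalar A})
    (p z q : A) :
  p * z * q = p * center phi z * q + phi z *: (p * q).
Proof.
by rewrite /center mulrBr mulrBl -scalerAr mulr1 -scalerAl subrK.
Qed.

Lemma centered_center_cons (R : realType) (A : algType R[i])
    (phi : {scalar A}) (x y : A) (s : seq A) :
  phi 1 = 1 -> centered phi (x :: rcons s y) ->
  centered phi (center phi (y * x) :: s).
Proof.
move=> phi1 cen z; rewrite inE => /predU1P[->|zs]; first exact: phi_center.
by apply: cen; rewrite inE mem_rcons inE zs !orbT.
Qed.

(** By traciality [y] can be moved to the front, where it meets [x]; the
    centered part of [y * x] gives a cyclically alternating centered word. *)
Lemma omega_peel (R : realType) (A : algType R[i]) (S1 S2 : set A)
    (phi omega : {scalar A}) (x y : A) (s : seq A) :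
  phi 1 = 1 -> tracial omega ->
  (forall s', cyclically_alternating S1 S2 s' -> centered phi s' ->
     omega (\prod_(u <- s') u) = 0) ->
  cyclically_alternating S1 S2 (center phi (y * x) :: s) ->
  centered phi (x :: rcons s y) ->
  omega (\prod_(u <- x :: rcons s y) u) =
    phi (y * x) * omega (\prod_(u <- s) u).
Proof.
move=> phi1 tr_w w_cyc cyc_z cen.
rewrite big_cons -cats1 big_cat big_seq1 /= mulrA tr_w mulrA.
rewrite -[y * x]mul1r (mul_center phi) !mul1r linearD linearZ /=.
have /= := w_cyc _ cyc_z (centered_center_cons phi1 cen).
by rewrite big_cons => ->; rewrite add0r.
Qed.

(** The extreme terms of the sum vanish because they contain [phi] of an
    alternating word: the given one without its first or its last letter.  In a
    middle term [y] is followed by [x]; replacing [y * x] by its centering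
    leaves the cyclically alternating word [center phi (y * x) :: s] with one
    letter deleted, on which [phi] vanishes, so that only the scalar
    [phi (y * x)] survives. *)
Lemma cyclic_leibniz_peel (R : realType) (A : algType R[i]) (S1 S2 : set A)
    (phi omega : {scalar A}) (x y : A) (s : seq A) :
  phi 1 = 1 ->
  (forall s', alternating S1 S2 s' -> centered phi s' ->
     phi (\prod_(u <- s') u) = 0) ->
  cyclically_alternating S1 S2 (center phi (y * x) :: s) ->
  alternating S1 S2 (x :: s) -> alternating S1 S2 (rcons s y) ->
  centered phi (x :: rcons s y) ->
  cyclic_leibniz phi omega (x :: rcons s y) =
    phi (y * x) * cyclic_leibniz phi omega s.
Proof.
move=> phi1 phi_alt cyc_z alt_xs alt_sy cen.
have cen_xs : centered phi (x :: s).
  move=> u; rewrite inE => us; apply: cen.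
  by rewrite inE mem_rcons inE orbCA us orbT.
have cen_sy : centered phi (rcons s y).
  by move=> u us; apply: cen; rewrite inE us orbT.
rewrite /cyclic_leibniz /= size_rcons big_ord_recl big_ord_recr /=.
rewrite drop0 big_nil mulr1 (phi_alt (rcons s y)) //.
rewrite drop_oversize ?size_rcons // big_nil mul1r.
rewrite -cats1 take_cat add0n ltnn subnn take0 cats0 phi_alt //.
rewrite !mulr0 add0r addr0 mulr_sumr; apply: eq_bigr => i _.
rewrite /bump /= add0n add1n nth_cat ltn_ord drop_cat take_cat ltn_ord.
rewrite mulrCA; congr (_ * _).
have -> : (if (i.+1 < size s)%N then drop i.+1 s ++ [:: y]
           else drop (i.+1 - size s) [:: y]) = rcons (drop i.+1 s) y.
  rewrite -cats1; case: ltnP => // le_si.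
  have -> : i.+1 = size s by apply/eqP; rewrite eqn_leq le_si ltn_ord.
  by rewrite subnn drop0 drop_size.
rewrite -cats1 big_cat big_seq1 big_cons /= mulrA.
rewrite -(mulrA _ y x) (mul_center phi).
rewrite linearD linearZ /=.
have := phi_cyclic_delete phi_alt cyc_z (centered_center_cons phi1 cen).
by move=> /(_ i.+1 (ltn_ord i)) /=; rewrite big_cons mulrA => ->; rewrite add0r.
Qed.

(** The induction removes both extreme letters at once.  In the peeling step
    the length is odd and at least three, so the inner word is nonempty. *)
Lemma cyclic_leibniz_formula (R : realType) (A : algType R[i]) (S1 S2 : set A)
    (phi omega : {scalar A}) :
  GRing.subalg_closed (mem S1) -> GRing.subalg_closed (mem S2) ->
  phi 1 = 1 -> tracial omega ->
  (forall s, alternating S1 S2 s -> centered phi s ->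
     phi (\prod_(x <- s) x) = 0) ->
  (forall s, cyclically_alternating S1 S2 s -> centered phi s ->
     omega (\prod_(x <- s) x) = 0) ->
  forall s, alternating S1 S2 s -> centered phi s ->
    omega (\prod_(x <- s) x) = cyclic_leibniz phi omega s.
Proof.
move=> subalg1 subalg2 phi1 tr_w phi_alt w_cyc s.
have [n] := ubnP (size s); elim: n s => // n IHn s le_sn alt_s cen_s.
case: (alt_s) => s_neq0 [t lts alt_t].
have [cyc_t|] := boolP (cycle (fun i k : bool => i != k) t).
  have cyc_s : cyclically_alternating S1 S2 s by split; last exists t.
  rewrite w_cyc // /cyclic_leibniz big1 // => i _.
  by rewrite (phi_cyclic_delete phi_alt) ?mulr0.
case: s => [//|x s] in le_sn alt_s cen_s s_neq0 lts *.
case/lastP: s => [|s y] in le_sn alt_s cen_s s_neq0 lts *.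
  by rewrite /cyclic_leibniz big_ord1 big_seq1 !big_nil mulr1 phi1 mulr1.
case: t => [//|b t] in lts alt_t *.
case/lastP: t => [|t c] in lts alt_t *.
  by have := all2_size lts; rewrite /= size_rcons.
move: (lts); rewrite /labelled /= all2_rcons => /and3P[xb ts yc].
move: (alt_t); rewrite /= !rcons_path last_rcons => /andP[alt_bt alt_tc].
(* [b :: rcons t c] is sorted but no cycle, so its extreme labels coincide. *)
rewrite alt_bt alt_tc negbK => /eqP eq_cb.
rewrite {c}eq_cb in lts alt_t yc alt_tc.
have t_neq0 : t != [::] by apply: contraTneq alt_tc => ->; rewrite /= eqxx.
have size_ts := all2_size ts.
have s_neq0' : s != [::] by rewrite -size_eq0 -size_ts size_eq0.
have z_in : center phi (y * x) \in (if b then S2 else S1).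
  have subalg : GRing.subalg_closed (mem (if b then S2 else S1)) by case: (b).
  have [in1 lin mul] := subalg.
  rewrite /center addrC -scaleNr; apply: lin => //; exact: mul.
have cyc_z : cyclically_alternating S1 S2 (center phi (y * x) :: s).
  split=> //; exists (b :: t); first by rewrite /labelled /= z_in.
  by rewrite /= rcons_path alt_bt.
have alt_xs : alternating S1 S2 (x :: s).
  by split=> //; exists (b :: t) => //; rewrite /labelled /= xb.
have alt_sy : alternating S1 S2 (rcons s y).
  split; first by case: (s).
  exists (rcons t b); last exact: path_sorted alt_t.
  by rewrite /labelled all2_rcons ts.
rewrite (omega_peel phi1 tr_w w_cyc) //.
rewrite (cyclic_leibniz_peel omega phi1 phi_alt) //.
rewrite IHn //.
- by move: le_sn; rewrite /= size_rcons !ltnS; exact: ltnW.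
- by split=> //; exists t => //; exact: path_sorted alt_bt.
- by move=> u us; apply: cen_s; rewrite inE mem_rcons inE us !orbT.
Qed.

(** * The product of two triples *)

Lemma range_subalg_closed (R : realType) (B A : algType R[i])
    (j : {lrmorphism B -> A}) : GRing.subalg_closed (mem (range j)).
Proof.
split.
- by rewrite -(rmorph1 j); exact: mem_range.
- move=> k _ _ /set_mem[u _ <-] /set_mem[v _ <-].
  by rewrite -linearP; exact: mem_range.
- move=> _ _ /set_mem[u _ <-] /set_mem[v _ <-].
  by rewrite -rmorphM; exact: mem_range.
Qed.

Lemma labelled_mem (R : realType) (A : algType R[i]) (S1 S2 : set A) t s x :
  labelled S1 S2 t s -> x \in s -> S1 x \/ S2 x.
Proof.
elim: t s => [|b t IHt] [|y s] //= /andP[yb /IHt ts].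
rewrite inE => /predU1P[->|/ts //].
by case: b yb => /set_mem; [right | left].
Qed.

Lemma prod_centered (R : realType) (A : algType R[i]) (phi : {scalar A}) s :
  s != [::] -> centered phi s -> \prod_(x <- s) phi x = 0.
Proof.
by case: s => // x s _ cen; rewrite big_cons cen ?mul0r ?mem_head.
Qed.

Theorem proposition3p2p4 (R : realType)
    (A1 A2 : algType R[i]) (A10 : set A1) (A20 : set A2)
    (aug1 : augmented A10) (aug2 : augmented A20)
    (psi1 phi1 omega1 : {scalar A1}) (psi2 phi2 omega2 : {scalar A2})
    (psi1_unital : psi1 1 = 1) (psi2_unital : psi2 1 = 1)
    (phi1_unital : phi1 1 = 1) (phi2_unital : phi2 1 = 1)
    (omega1_tracial : tracial omega1) (omega2_tracial : tracial omega2)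
    (omega_one : omega1 1 = omega2 1)
    (A : algType R[i])
    (j1 : {lrmorphism A1 -> A}) (j2 : {lrmorphism A2 -> A})
    (A_free : is_free_product j1 j2)
    (psi phi omega : {scalar A})
    (product : is_cyclic_cfree_product j1 j2
                 psi1 phi1 omega1 psi2 phi2 omega2 psi phi omega)
    (psi1_phi1 : psi1 =1 phi1) (psi2_phi2 : psi2 =1 phi2) :
  (forall s : seq A,
     alternating (range j1) (range j2) s -> centered phi s ->
     phi (\prod_(x <- s) x) = 0 /\
     omega (\prod_(x <- s) x) =
       \sum_(i < size s)
         omega s`_i *
         phi (\prod_(x <- drop i.+1 s) x * \prod_(x <- take i s) x)) /\
  (tracial phi -> infinitesimally_free phi omega (range j1) (range j2)).
Proof.
case: product => psi_j1 psi_j2 phi_j1 phi_j2 _ _ tr_w _ phiM omegaM.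
have cen_psi t s : labelled (range j1) (range j2) t s -> centered phi s ->
    centered psi s.
  move=> lts cen x xs; rewrite -(cen x xs).
  case: (labelled_mem lts xs) => -[a _ <-].
    by rewrite psi_j1 phi_j1 psi1_phi1.
  by rewrite psi_j2 phi_j2 psi2_phi2.
have phi_one : phi 1 = 1 by rewrite -(rmorph1 j1) phi_j1.
have phi_alt s : alternating (range j1) (range j2) s -> centered phi s ->
    phi (\prod_(x <- s) x) = 0.
  move=> alt_s cen; case: (alt_s) => s_neq0 [t lts _].
  by rewrite phiM ?prod_centered //; exact: (cen_psi t).
have w_cyc s : cyclically_alternating (range j1) (range j2) s ->
    centered phi s -> omega (\prod_(x <- s) x) = 0.
  move=> cyc_s cen; case: (cyc_s) => s_neq0 [t lts _].
  by rewrite omegaM ?prod_centered //; exact: (cen_psi t).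
have sub1 := range_subalg_closed j1; have sub2 := range_subalg_closed j2.
have formula := cyclic_leibniz_formula sub1 sub2 phi_one tr_w phi_alt w_cyc.
split=> [s alt_s cen | tr_phi].
  by split; [exact: phi_alt | exact: formula].
split=> // s alt_s cen; rewrite formula //.
by apply: eq_bigr => i _; rewrite tr_phi.
Qed.
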